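(* Let $S$ be a completely simple semigroup (resp. a completely $0$-simple semigroup). If $S$ admits a bounded below weight $\omega$ for which the associated function $\Omega$ is $0$-cluster, then $S$ is countable.
   Context: A weight on a semigroup $S$ is a function $\omega:S\to(0,\infty)$ with $\omega(st)\le\omega(s)\omega(t)$ for all $s,t\in S$. It is bounded below if $\inf_{s\in S}\omega(s)>0$. The function $\Omega:S\times S\to(0,1]$ associated with $\omega$ is $\Omega(s,t)=\frac{\omega(st)}{\omega(s)\omega(t)}$. $\Omega$ is called $0$-cluster if for each pair of sequences $(x_n)$, $(y_m)$, each consisting of distinct elements of $S$, one has $\lim_n\lim_m\Omega(x_n,y_m)=0=\lim_m\lim_n\Omega(x_n,y_m)$ whenever both iterated limits exist. ''Countable'' means finite or countably infinite. A semigroup is simple if it has no proper (two-sided) ideals; a semigroup with zero $0$ is $0$-simple if $S^2\ne\{0\}$ and its only ideals are $\{0\}$ and $S$. On idempotents, consider the partial order $e\le f$ iff $ef=fe=e$. A simple semigroup is completely simple if it contains an idempotent that is minimal for this order; a $0$-simple semigroup is completely $0$-simple if it contains an idempotent that is minimal among the nonzero idempotents. Equivalently (Rees), a completely $0$-simple semigroup is one isomorphic to $M^0(G,I,\Lambda;P)=(I\times G\times\Lambda)\cup\{0\}$, where $G$ is a group, $I,\Lambda$ are nonempty sets and $P=(p_{\lambda i})$ is a $\Lambda\times I$ matrix with entries in $G\cup\{0\}$ having a nonzero entry in every row and every column, with multiplication $(i,a,\lambda)(j,b,\mu)=(i,ap_{\lambda j}b,\mu)$ if $p_{\lambda j}\neq0$,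 $=0$ if $p_{\lambda j}=0$, and all products involving $0$ equal to $0$; a completely simple semigroup is one isomorphic to $I\times G\times\Lambda$ with multiplication $(i,a,\lambda)(j,b,\mu)=(i,ap_{\lambda j}b,\mu)$, where all entries $p_{\lambda j}$ lie in $G$. *)

(* Defs.v *)
From mathcomp Require Import all_boot all_order all_algebra.
From mathcomp Require Import all_classical all_reals all_analysis.

Set Implicit Arguments.
Unset Strict Implicit.
Unset Printing Implicit Defensive.

Import Order.TTheory GRing.Theory Num.Theory.
Import numFieldNormedType.Exports.

Local Open Scope classical_set_scope.
Local Open Scope ring_scope.

(* The choiceType structure carried by a semigroupType is no restriction:
   classically every type has one (gen_choiceMixin). *)

Definition ideal (S : semigroupType) (I : set S) : Prop :=
  I !=set0 /\ forall s x : S, I x -> I (s * x)%g /\ I (x * s)%g.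

Definition idem (S : semigroupType) (e : S) : Prop := (e * e)%g = e.

Definition idem_le (S : semigroupType) (e f : S) : Prop :=
  (e * f)%g = e /\ (f * e)%g = e.

Definition is_zero (S : semigroupType) (z : S) : Prop :=
  forall s : S, (z * s)%g = z /\ (s * z)%g = z.

Definition simple_semigroup (S : semigroupType) : Prop :=
  forall I : set S, ideal I -> I = [set: S].

Definition zero_simple_semigroup (S : semigroupType) (z : S) : Prop :=
  [/\ is_zero z,
      [set (s * t)%g | s in [set: S] & t in [set: S]] <> [set z] &
      forall I : set S, ideal I -> I = [set z] \/ I = [set: S]].

Definition completely_simple (S : semigroupType) : Prop :=
  simple_semigroup S /\
  exists2 e : S, idem e & forall f : S, idem f -> idem_le f e -> f = e.

Definition completely_zero_simple (S : semigroupType) : Prop :=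
  exists2 z : S, zero_simple_semigroup z &
  exists2 e : S, idem e /\ e <> z &
    forall f : S, idem f -> f <> z -> idem_le f e -> f = e.

Definition weight (R : realType) (S : semigroupType) (w : S -> R) : Prop :=
  (forall s, 0 < w s) /\ forall s t, w (s * t)%g <= w s * w t.

(* On a nonempty S, a weight has range bounded below by 0, so that inf is the
   genuine infimum here. *)
Definition bounded_below (R : realType) (S : semigroupType) (w : S -> R) :
  Prop := 0 < inf (range w).

Definition Omega (R : realType) (S : semigroupType) (w : S -> R) (s t : S) : R :=
  w (s * t)%g / (w s * w t).

(* lim_n lim_m a n m exists and equals l; in particular every inner limit
   exists. *)
Definition iterated_lim (R : realType) (a : nat -> nat -> R) (l : R) : Prop :=
  exists2 b : nat -> R,
    forall n, a n m @[m --> \oo] --> b n & b n @[n --> \oo] --> l.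

Definition zero_cluster (R : realType) (S : semigroupType) (K : S -> S -> R) :
  Prop :=
  forall x y : nat -> S, injective x -> injective y ->
  forall l l' : R,
    iterated_lim (fun n m => K (x n) (y m)) l ->
    iterated_lim (fun m n => K (x n) (y m)) l' ->
    l = 0 /\ l' = 0.

(* Main.v *)
Require Import Defs.
From mathcomp Require Import all_boot all_order all_algebra.
From mathcomp Require Import all_classical all_reals all_analysis.

(* If [w >= d > 0], then [Omega w >= d / k ^ 2] on every sublevel set
   [w <= k].  An infinite sublevel set would contain a sequence along which both
   iterated limits of [Omega w] exist (Grothendieck's double limit argument:
   take limits along a nonprincipal ultrafilter, and realise the countably many
   limits involved by one subsequence), and they would be at least
   [d / k ^ 2 > 0].  So all sublevel sets are finite, and [S] is their countable
   union. *)

Import Order.TTheory GRing.Theory Num.Theory.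
Import numFieldNormedType.Exports.

Local Open Scope classical_set_scope.
Local Open Scope ring_scope.

(** Compactness yields a cluster point; an ultrafilter contains the preimage of each neighbourhood
    or its complement, and clustering rules out the complement. *)
Lemma ultra_cvg_compact (I : Type) (T : topologicalType) (U : set_system I)
    (UU : UltraFilter U) (A : set T) (f : I -> T) :
  compact A -> (forall i, A (f i)) -> exists2 p : T, A p & f @ U --> p.
Proof.
move=> cA fA; have [|p [Ap fUp]] := cA (f @ U) _ _.
  by apply: (@filterS _ U _ setT) => [i _|]; [exact: fA|exact: filterT].
exists p => // B pB.
have [//|fB] := in_ultra_setVsetC (f @^-1` B) UU.
by have [t []] := fUp (~` B) B fB pB.
Qed.

(** Diagonal choice: finite intersections of the sets lie in [U], hence meet every tail, so [phi n]
    can be picked beyond its predecessor in the first [n.+1] sets. *)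
Lemma pseudo_intersection (I : countType) (U : set_system nat)
    (UF : ProperFilter U) (A : I -> set nat) :
  \oo `<=` U -> (forall i, U (A i)) ->
  exists2 phi : nat -> nat, {homo phi : n m / (n < m)%N} &
    forall i, \forall n \near \oo, A i (phi n).
Proof.
move=> ooU UA.
(* Codes that decode to nothing get [setT], which imposes no constraint. *)
pose B k := if pickle_inv k is Some i then A i else setT.
have UB k : U (\bigcap_(i in [set i | (i <= k)%N]) B i).
  elim: k => [|k IH].
    have : U (B 0%N) by rewrite /B; case: pickle_inv => [i|]; [|exact: filterT].
    by apply: filterS => m B0 i /=; rewrite leqn0 => /eqP ->.
  have UBk : U (B k.+1).
    by rewrite /B; case: pickle_inv => [i|]; [|exact: filterT].
  apply: filterS (filterI IH UBk) => m [IHm Bm] i /=.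
  by rewrite leq_eqVlt => /orP[/eqP ->//|]; exact: IHm.
have next (k p : nat) : {m : nat | (p < m)%N /\ forall i, (i <= k)%N -> B i m}.
  apply: cid; apply: (@filter_ex _ U); apply: filterI; last exact: UB.
  by apply: ooU; exact: nbhs_infty_gt.
pose fix phi (n : nat) : nat :=
  if n is k.+1 then sval (next k.+1 (phi k)) else sval (next 0%N 0%N).
have phiB n i : (i <= n)%N -> B i (phi n).
  by case: n => [|n] /=; case: (next _ _) => m /= [_]; exact.
exists phi.
  apply: homo_ltn => [m n p|n /=]; first exact: ltn_trans.
  by case: (next _ _) => m /= [].
move=> i; apply: filterS (nbhs_infty_ge (pickle i)) => n /phiB.
by rewrite /B pickleK_inv.
Qed.

Lemma cvg_subsequence (R : realType) (I : countType) (U : set_system nat)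
    (UF : ProperFilter U) (g : I -> nat -> R) (l : I -> R) :
  \oo `<=` U -> (forall i, g i @ U --> l i) ->
  exists2 phi : nat -> nat, {homo phi : n m / (n < m)%N} &
    forall i, g i (phi n) @[n --> \oo] --> l i.
Proof.
move=> ooU gl.
(* Countably many conditions suffice: one for each function and each radius [1 / (j + 1)]. *)
pose A (ij : I * nat) := [set m | `|l ij.1 - g ij.1 m| < ij.2.+1%:R^-1].
have [|phi phi_lt phiA] := @pseudo_intersection _ U UF A ooU.
  by move=> [i j]; move/cvgrPdist_lt : (gl i); apply; rewrite invr_gt0 ltr0n.
exists phi => // i; apply/cvgrPdist_lt => e e0.
have [j je] := filter_ex (near_infty_natSinv_lt (PosNum e0)).
by apply: filterS (phiA (i, j)) => n /= /lt_trans; apply.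
Qed.

Lemma iterated_lim_subsequence (R : realType) (a : nat -> nat -> R) (c d : R) :
  (forall n m, c <= a n m <= d) ->
  exists2 phi : nat -> nat, injective phi &
  exists l l', [/\ c <= l, c <= l',
    iterated_lim (fun n m => a (phi n) (phi m)) l &
    iterated_lim (fun m n => a (phi n) (phi m)) l'].
Proof.
move=> acd.
have [U [UU ooU]] := ultraFilterLemma eventually_filter.
pose L (f : nat -> R) := lim (f @ U).
have HL f : (forall n, c <= f n <= d) -> c <= L f <= d /\ f @ U --> L f.
  move=> fcd.
  have [|p] := ultra_cvg_compact _ _ _ UU _ f (@segment_compact R c d).
    by move=> n /=; rewrite in_itv /= fcd.
  by rewrite /= in_itv /= => pcd fp; rewrite /L (cvg_lim _ fp).
pose b n := L (a n); pose b' m := L (fun n => a n m).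
have bcd n : c <= b n <= d by have [] := HL (a n) (acd n).
have b'cd m : c <= b' m <= d by have [] := HL (fun n => a n m) (fun n => acd n m).
(* [Some] indexes the rows ([true]) and columns ([false]) of [a], [None] their limit functions [b]
   and [b']. This family is countable, so one [phi] serves all inner and outer limits. *)
pose g (i : bool * option nat) : nat -> R :=
  match i with
  | (true, Some n) => a n | (true, None) => b
  | (false, Some m) => fun n => a n m | (false, None) => b'
  end.
have gcd i n : c <= g i n <= d by case: i => -[] [k|] /=.
have [|phi phi_lt phig] := @cvg_subsequence R _ U _ g (L \o g) ooU.
  by move=> i; have [] := HL _ (gcd i).
exists phi.
  by move=> n m phinm; case: (ltngtP n m) => // /phi_lt; rewrite phinm ltnn.
exists (L b), (L b'); split.
- by have [/andP[]] := HL b bcd.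
- by have [/andP[]] := HL b' b'cd.
- exists (b \o phi) => [n|]; first exact: (phig (true, Some (phi n))).
  exact: (phig (true, None)).
- exists (b' \o phi) => [n|]; first exact: (phig (false, Some (phi n))).
  exact: (phig (false, None)).
Qed.

Lemma zero_cluster_sublevel_finite (R : realType) (S : semigroupType)
    (w : S -> R) (d k : R) :
  weight w -> 0 < d -> (forall s, d <= w s) -> zero_cluster (Omega w) ->
  finite_set [set s | w s <= k].
Proof.
move=> [w_gt0 wM] d0 dw w0; apply: contrapT => /infiniteP/card_leP/unsquash f.
pose x n := set_val (f (to_setT n)).
have xinj : injective x.
  move=> n m /val_inj /'inj_f; rewrite !in_setT => /(_ isT isT).
  by move/(congr1 set_val).
have xk n : w (x n) <= k by exact: set_valP (f (to_setT n)).
have k0 : 0 < k by apply: lt_le_trans (xk 0%N); exact: w_gt0.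
(* The numerator is at least [d] and both factors below are at most [k]; the bound 1 is
   submultiplicativity. *)
have Omega_itv n m : d / k ^+ 2 <= Omega w (x n) (x m) <= 1.
  have w2_gt0 : 0 < w (x n) * w (x m) by rewrite mulr_gt0.
  rewrite /Omega [X in _ && X]ler_pdivrMr // mul1r wM andbT ler_pM ?(ltW d0) //.
    by rewrite invr_ge0 ltW // exprn_gt0.
  rewrite lef_pV2 ?posrE ?exprn_gt0 // expr2.
  by rewrite ler_pM ?(ltW (w_gt0 _)) //; exact: xk.
have [phi phi_inj [l [l' [cl _ Hl Hl']]]] :=
  iterated_lim_subsequence _ _ _ _ Omega_itv.
have xphi_inj : injective (x \o phi) by exact: inj_comp.
(* The same sequence is used in both arguments of [Omega w]. *)
have [l0 _] := w0 _ _ xphi_inj xphi_inj l l' Hl Hl'.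
by move: cl; rewrite l0 leNgt divr_gt0 // exprn_gt0.
Qed.

Theorem theorem3p5 (R : realType) (S : semigroupType)
  (hS : completely_simple S \/ completely_zero_simple S)
  (hw : exists w : S -> R,
      [/\ weight w, bounded_below w & zero_cluster (Omega w)]) :
  countable [set: S].
Proof.
have [w [weight_w w_inf w0]] := hw.
have w_ge s : inf (range w) <= w s.
  apply: ge_inf; last by exists s.
  (* Positivity of [w] gives the lower bound 0, which makes [inf] a true infimum. *)
  by exists 0 => _ [t _ <-]; rewrite ltW //; case: weight_w.
have -> : [set: S] = \bigcup_(k in [set: nat]) [set s | w s <= k%:R].
  apply/seteqP; split => // s _; exists (Num.trunc (w s)).+1 => //=.
  by rewrite ltW // truncnS_gt.
apply: bigcup_countable => // k _; apply: finite_set_countable.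
exact: zero_cluster_sublevel_finite w_ge w0.
Qed.
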